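(* Let $M$ be a compact connected polyhedron and let $f$ be a periodic map on $M$. Suppose there are $l$ points of $M$ whose $f$-orbits have pairwise coprime lengths, all greater than $1$. If there is an $f$-equivariant embedding $e: M\to\mathbb{R}^m$, then $m\ge 2l$.
   Context: A periodic map $f$ on $M$ is a homeomorphism $f: M\to M$ of finite order $n$; it generates a faithful action of the cyclic group $\mathbb{Z}_n$ on $M$. The length of the $f$-orbit of a point $x$ is the number of elements of $\{f^k(x): k\in\mathbb{Z}\}$. An embedding $e: M\to\mathbb{R}^m$ is called $f$-equivariant if, for the cyclic group $G=\langle f\rangle\cong\mathbb{Z}_n$, there is a group homomorphism $\tilde\rho: G\to SO(m)$, with $SO(m)$ acting canonically on $\mathbb{R}^m$, such that $e\circ g=\tilde\rho(g)\circ e$ for every $g\in G$. *)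

(* Defs.v *)
From HB Require Import structures.
From mathcomp Require Import all_boot all_order all_algebra.
From mathcomp Require Import finmap.
From mathcomp Require Import all_classical all_reals all_analysis.

Set Implicit Arguments.
Unset Strict Implicit.
Unset Printing Implicit Defensive.

Import Order.TTheory GRing.Theory Num.Theory.
Import numFieldNormedType.Exports.

Local Open Scope classical_set_scope.
Local Open Scope ring_scope.

Record homeomorphism (M N : topologicalType) := Homeomorphism {
  hfun :> M -> N;
  hinv : N -> M;
  hfunK : cancel hfun hinv;
  hinvK : cancel hinv hfun;
  hfun_continuous : continuous hfun;
  hinv_continuous : continuous hinv }.

Definition topological_embedding (M N : topologicalType) (e : M -> N) : Prop :=
  [/\ continuous e, injective e &
      forall U : set M, open U ->
        exists2 V : set N, open V & e @` U = V `&` range e].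

Definition hpow (M : topologicalType) (f : homeomorphism M M) (k : int) :
    M -> M :=
  match k with
  | Posz n => iter n f
  | Negz n => iter n.+1 (hinv f)
  end.

Definition has_order (M : topologicalType) (f : homeomorphism M M) (n : nat) :
    Prop :=
  [/\ (0 < n)%N, iter n f = id &
      forall k : nat, (0 < k < n)%N -> iter k f <> id].

Definition periodic_map (M : topologicalType) (f : homeomorphism M M) : Prop :=
  exists n : nat, has_order f n.

Definition cyclic_group (M : topologicalType) (f : homeomorphism M M) :
    set (M -> M) :=
  range (hpow f).

Definition orbit_of (M : topologicalType) (f : homeomorphism M M) (x : M) :
    set M :=
  [set hpow f k x | k in [set: int]].

Definition orbit_has_length (M : topologicalType) (f : homeomorphism M M)
    (x : M) (d : nat) : Prop :=
  (orbit_of f x #= `I_d)%card.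

Definition special_orthogonal (R : realType) (m : nat) : set 'M[R]_m :=
  [set A | A *m A^T = 1%:M /\ \det A = 1].

(* Only the values of [rho] on the group [cyclic_group f] matter: those outside
   it are unconstrained. *)
Definition SO_representation (R : realType) (m : nat) (M : topologicalType)
    (f : homeomorphism M M) (rho : (M -> M) -> 'M[R]_m) : Prop :=
  (forall g, cyclic_group f g -> special_orthogonal (rho g)) /\
  (forall g h, cyclic_group f g -> cyclic_group f h ->
     rho (g \o h) = rho g *m rho h).

Definition equivariant_embedding (R : realType) (m : nat)
    (M : topologicalType) (f : homeomorphism M M) (e : M -> 'cV[R]_m) : Prop :=
  topological_embedding e /\
  exists2 rho : (M -> M) -> 'M[R]_m, SO_representation f rho &
    forall g, cyclic_group f g -> e \o g = mulmx (rho g) \o e.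

Section Polyhedra.
Context {R : realType} {N : nat}.
Implicit Types (s t u : {fset 'cV[R]_N}) (K : {fset {fset 'cV[R]_N}}).

Definition affinely_independent s : Prop :=
  forall w : 'cV[R]_N -> R,
    \sum_(v <- s) w v = 0 -> \sum_(v <- s) w v *: v = 0 ->
    forall v, v \in s -> w v = 0.

Definition convex_hull s : set 'cV[R]_N :=
  [set x | exists w : 'cV[R]_N -> R,
    [/\ forall v, v \in s -> 0 <= w v,
        \sum_(v <- s) w v = 1 &
        x = \sum_(v <- s) w v *: v]].

(* A simplex is represented by its vertex set.  In the last clause [u] is empty
   exactly when the two simplices are disjoint. *)
Definition simplicial_complex K : Prop :=
  [/\ forall s, s \in K -> s != fset0 /\ affinely_independent s,
      forall s t, s \in K -> t != fset0 -> (t `<=` s)%fset -> t \in K &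
      forall s t, s \in K -> t \in K ->
        exists u, [/\ (u `<=` s)%fset, (u `<=` t)%fset &
          convex_hull s `&` convex_hull t = convex_hull u]].

Definition underlying_space K : set 'cV[R]_N :=
  \bigcup_(s in [set` K]) convex_hull s.

End Polyhedra.

(* Finitely many simplices: this is what makes the polyhedron compact. *)
Definition compact_polyhedron (R : realType) (M : topologicalType) : Prop :=
  exists N : nat, exists K : {fset {fset 'cV[R]_N}},
    simplicial_complex K /\
    exists2 h : M -> 'cV[R]_N,
      topological_embedding h & range h = underlying_space K.

(* Main.v *)
Require Import Defs.
From mathcomp Require Import all_boot all_order all_algebra.
From mathcomp Require Import all_classical all_reals all_analysis.
Import numFieldNormedType.Exports.
Local Open Scope classical_set_scope.
Local Open Scope ring_scope.

(** The statement is linear algebra on the matrix [A] representing [f].  Write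
[q_d] for the polynomial 1 + X + ... + X^(d-1).

A point [y] whose orbit has length [d > 1] gives a vector [e y - e (f y)]; it is
nonzero because [e] is injective, and [q_d(A)] kills it because [A^d] fixes
[e y] and [(1 - X) q_d = 1 - X^d].  So each [x i] contributes a nonzero subspace
[W_i = ker q_(d i)(A)].  Coprimality of the lengths makes the polynomials
[q_(d i)] pairwise coprime ([geom_poly_coprime]), so the sum of the [W_i] is
direct and the sum of their dimensions is at most [m].

It remains to see that no [W_i] is a line ([rank_ker_geom_poly]).  On an
invariant line the orthogonal matrix [A] acts as 1 or -1, and 1 is excluded
because [q_d(1) = d] is nonzero.  If it acts as -1, then [q_d(-1) = 0], so the
whole (-1)-eigenspace lies in [W_i] and is that line.  But a rotation never has
a (-1)-eigenspace of dimension exactly one ([rank_eigenspaceN1]): composing with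
the reflection that fixes the orthogonal complement of the line would give an
orthogonal matrix of determinant -1 without the eigenvalue -1, contradicting
[det_orthogonal_eq1].

Kernels and eigenspaces are those of the action on row vectors, so the argument
is carried out for the transpose of [A]. *)

Import Order.TTheory GRing.Theory Num.Theory.

(** * The (-1)-eigenspace of a rotation *)

Section Rotations.
Context {F : realFieldType}.

Lemma row_normsq_eq0 {n} (u : 'rV[F]_n) : ((u *m u^T) 0 0 == 0) = (u == 0).
Proof.
apply/idP/eqP => [|->]; last by rewrite mul0mx mxE.
rewrite mxE psumr_eq0 => [/allP u0|i _]; last by rewrite mxE -expr2 sqr_ge0.
apply/rowP => i; have := u0 i (mem_index_enum i).
by rewrite !mxE -expr2 sqrf_eq0 => /eqP.
Qed.

(** Factoring [C + 1 = C (1 + C^T)] shows that [\det (C + 1)] is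
[\det C * \det (C + 1)], and the absence of the eigenvalue -1 makes
[\det (C + 1)] cancellable. *)
Lemma det_orthogonal_eq1 {n} (C : 'M[F]_n) :
  C *m C^T = 1%:M -> (forall v : 'rV_n, v *m C = - v -> v = 0) -> \det C = 1.
Proof.
move=> CCT noN1.
have detC1 : \det (C + 1%:M) != 0.
  apply/det0P => -[v v0]; rewrite mulmxDr mulmx1 => /eqP.
  by rewrite addr_eq0 => /eqP/noN1 v_eq0; rewrite v_eq0 eqxx in v0.
apply: (mulIf detC1); rewrite mul1r -[X in _ * X = _]det_tr -det_mulmx.
by rewrite linearD /= trmx1 mulmxDr CCT mulmx1 addrC.
Qed.

(** The two block-triangular factorizations of the block matrix with identity
diagonal blocks and off-diagonal blocks [c] and [r] give two expressions of its
determinant. *)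
Lemma det_rank1_update {n} (c : 'cV[F]_n) (r : 'rV[F]_n) :
  \det (1%:M - c *m r) = 1 - (r *m c) 0 0.
Proof.
pose L := block_mx 1%:M 0 r (1%:M : 'M[F]_1).
have e1 : L *m block_mx 1%:M c 0 (1%:M - r *m c) = block_mx 1%:M c r 1%:M.
  rewrite mulmx_block !(mul1mx, mul0mx, mulmx1, mulmx0, addr0).
  by rewrite addrC subrK.
have e2 : block_mx (1%:M - c *m r) c 0 1%:M *m L = block_mx 1%:M c r 1%:M.
  by rewrite mulmx_block !(mul1mx, mul0mx, mulmx1, mulmx0, addr0, add0r) subrK.
have := congr1 determinant (etrans e1 (esym e2)).
rewrite !det_mulmx det_lblock !det_ublock !det1 !mul1r !mulr1 => <-.
by rewrite det_mx11 !mxE.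
Qed.

Lemma rank_eigenspaceN1 {n} (B : 'M[F]_n) :
  B *m B^T = 1%:M -> \det B = 1 -> \rank (eigenspace B (-1)) != 1%N.
Proof.
move=> BBT detB; apply/eqP => rk1.
have /rowV0Pn[u uE u0] : eigenspace B (-1) != 0 by rewrite -mxrank_eq0 rk1.
have Eu : (eigenspace B (-1) <= u)%MS.
  by have [_ <-] := mxrank_leqif_sup uE; rewrite rk1 rank_rV u0.
have uB : u *m B = - u by move/eigenspaceP: uE => ->; rewrite scaleN1r.
have Bu : B *m u^T = - u^T.
  apply: trmx_inj; rewrite trmx_mul trmxK linearN /= trmxK.
  by rewrite -[in RHS](mulmx1 u) -BBT mulmxA uB mulNmx opprK.
pose s := (u *m u^T) 0 0.
have s0 : s != 0 by rewrite row_normsq_eq0.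
have uu : u *m u^T = s%:M by apply: mx11_scalar.
(* [H] is the reflection in the hyperplane orthogonal to [u]. *)
pose c := 2 / s; have cs : c * s = 2 by rewrite divfK.
pose H : 'M[F]_n := 1%:M - u^T *m (c *: u).
have HT : H^T = H.
  by rewrite linearB /= trmx1 trmx_mul trmxK linearZ /= -scalemxAl scalemxAr.
have Hu : H *m u^T = - u^T.
  rewrite mulmxBl mul1mx -mulmxA -scalemxAl uu scale_scalar_mx cs.
  by rewrite mul_mx_scalar scaler_nat mulr2n opprD addrA subrr sub0r.
have HH : H *m H = 1%:M.
  rewrite {2}/H mulmxBr mulmx1 mulmxA Hu mulNmx opprK.
  by rewrite subrK.
have detH : \det H = -1.
  rewrite det_rank1_update -scalemxAl uu scale_scalar_mx cs mxE.
  by rewrite eqxx mulr1n -[2]/(1 + 1) opprD addrA subrr sub0r.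
have : \det (B *m H) = 1.
  apply: det_orthogonal_eq1.
    by rewrite trmx_mul HT mulmxA -(mulmxA B) HH mulmx1.
  move=> v vBH.
  have vu : v *m u^T = 0.
    have := congr1 (mulmx^~ u^T) vBH.
    rewrite /= -!mulmxA Hu mulmxN Bu opprK mulNmx => /eqP.
    rewrite -subr_eq0 opprK -mulr2n -scaler_nat scaler_eq0 pnatr_eq0 /=.
    by move/eqP.
  have vE : (v <= eigenspace B (-1))%MS.
    apply/eigenspaceP; rewrite scaleN1r -vBH mulmxA mulmxBr mulmx1.
    by rewrite !mulmxA -(mulmxA v) Bu mulmxN vu oppr0 mul0mx subr0.
  have /sub_rVP[a va] := submx_trans vE Eu.
  move: vu; rewrite va -scalemxAl uu scale_scalar_mx => /matrixP/(_ 0 0).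
  rewrite !mxE eqxx mulr1n => /eqP; rewrite mulf_eq0 (negPf s0) orbF => /eqP->.
  by rewrite scale0r.
rewrite det_mulmx detB mul1r detH => /eqP.
by rewrite eq_sym -subr_eq0 opprK -[1 + 1]/2 pnatr_eq0.
Qed.

End Rotations.

(** * Geometric polynomials *)

Definition geom_poly (F : fieldType) (d : nat) : {poly F} := \sum_(k < d) 'X^k.

Section GeomPoly.
Context {F : fieldType}.
Local Notation q := (geom_poly F).

Lemma geom_poly_mulXB1 d : ('X - 1) * q d = 'X^d - 1.
Proof. by rewrite subrX1. Qed.

Lemma geom_polyS d : q d.+1 = 1 + 'X * q d.
Proof.
rewrite /geom_poly big_ord_recl expr0 mulr_sumr; congr (_ + _).
by apply: eq_bigr => i _; rewrite -exprS.
Qed.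

Lemma geom_poly_dvd a k : q a %| q (k * a).
Proof.
have X1 : 'X - 1 != 0 :> {poly F} by rewrite polyXsubC_eq0.
rewrite -(dvdp_mul2l _ _ X1) !geom_poly_mulXB1.
rewrite mulnC exprM [X in _ %| X]subrX1; exact: dvdp_mulIl.
Qed.

(** A relation [u a = v b + 1] lifts to the Bezout identity
[q (u a) - X * q (v b) = 1]. *)
Lemma geom_poly_coprime a b : (0 < a)%N -> coprime a b -> coprimep (q a) (q b).
Proof.
move=> a0 /eqP ab1; case: (egcdnP b a0) => u v; rewrite ab1 addn1 => uv _.
apply/Bezout_eq1_coprimepP.
have /dvdpP[r qr] := geom_poly_dvd a u; have /dvdpP[t qt] := geom_poly_dvd b v.
exists (r, - 'X * t) => /=.
by rewrite -qr uv geom_polyS -mulrA -qt mulNr addrK.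
Qed.

End GeomPoly.

(** * Kernels of geometric polynomials of a rotation *)

Lemma geom_poly_horner_ker {F : fieldType} {n} (B : 'M[F]_n.+1) d
    (v : 'rV[F]_n.+1) :
  v *m B ^+ d = v -> (v - v *m B <= kermxpoly B (geom_poly F d))%MS.
Proof.
move=> vBd; apply/sub_kermxP.
have -> : v - v *m B = v *m horner_mx B (1 - 'X).
  by rewrite rmorphB rmorph1 /= horner_mx_X mulmxBr mulmx1.
rewrite -mulmxA -[_ *m horner_mx _ _]/(_ * _) -rmorphM /=.
rewrite -opprB mulNr geom_poly_mulXB1 opprB rmorphB rmorph1 rmorphXn /=.
by rewrite horner_mx_X mulmxBr mulmx1 vBd subrr.
Qed.

Lemma horner_mx_eigen {F : fieldType} {n} (B : 'M[F]_n.+1) a (v : 'rV[F]_n.+1)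
    (p : {poly F}) :
  v *m B = a *: v -> v *m horner_mx B p = p.[a] *: v.
Proof.
move=> va; elim/poly_ind: p => [|p c IH].
  by rewrite rmorph0 mulmx0 horner0 scale0r.
rewrite rmorphD rmorphM /= horner_mx_X horner_mx_C mulmxDr mulmxA IH.
rewrite -scalemxAl va mul_mx_scalar scalerA -scalerDl.
by rewrite !hornerE.
Qed.

Lemma rank_ker_geom_poly {F : realFieldType} {n} (B : 'M[F]_n.+1) d
    (v : 'rV[F]_n.+1) :
  B *m B^T = 1%:M -> \det B = 1 -> (0 < d)%N ->
  v != 0 -> (v <= kermxpoly B (geom_poly F d))%MS ->
  (2 <= \rank (kermxpoly B (geom_poly F d)))%N.
Proof.
move=> BBT detB d0 v0 vK; set K := kermxpoly _ _ in vK *.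
have rkv : \rank v = 1%N by rewrite rank_rV v0.
have rk_ge1 : (1 <= \rank K)%N by rewrite -rkv mxrankS.
rewrite ltn_neqAle rk_ge1 andbT; apply/eqP => rk1.
have Kv : (K <= v)%MS.
  by have [_ <-] := mxrank_leqif_sup vK; rewrite -rk1 rkv.
have stK : (v *m B <= v)%MS.
  apply: submx_trans Kv; apply: submx_trans (submxMr B vK) _.
  exact: comm_mx_stable_kermxpoly.
have /sub_rVP[a va] := stK.
have a2 : a ^+ 2 = 1.
  have : (v *m B) *m (v *m B)^T = v *m v^T.
    by rewrite trmx_mul mulmxA -(mulmxA v) BBT mulmx1.
  rewrite va linearZ /= -scalemxAl -scalemxAr scalerA -expr2.
  move=> /matrixP/(_ 0 0); rewrite mxE => /eqP.
  by rewrite -subr_eq0 -[X in _ - X]mul1r -mulrBl mulf_eq0 row_normsq_eq0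
     (negPf v0) orbF subr_eq0 => /eqP.
have qa : (geom_poly F d).[a] = 0.
  have /sub_kermxP := vK; rewrite (horner_mx_eigen _ _ _ _ va) => /eqP.
  by rewrite scaler_eq0 (negPf v0) orbF => /eqP.
have a1 : a != 1.
  apply: contra_eqN qa => /eqP ->; rewrite /geom_poly horner_sum.
  rewrite (eq_bigr (fun=> 1)); last by move=> i _; rewrite hornerXn expr1n.
  by rewrite sumr_const card_ord pnatr_eq0 -lt0n.
have aN1 : a = -1.
  by move/eqP: a2; rewrite sqrf_eq1 (negPf a1) => /eqP.
rewrite {}aN1 in va qa.
have vE : (v <= eigenspace B (-1))%MS by apply/eigenspaceP.
have EK : (eigenspace B (-1) <= K)%MS.
  apply/row_subP => i; apply/sub_kermxP.
  have /eigenspaceP/(horner_mx_eigen _ _ _ _) -> := row_sub i (eigenspace B (-1)).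
  by rewrite qa scale0r.
have /eqP[] := rank_eigenspaceN1 B BBT detB; apply/eqP.
by rewrite eqn_leq {1}rk1 mxrankS // -rkv mxrankS.
Qed.

(** * Orbits of a periodic map *)

(** The orbit is enumerated injectively by the first [p] iterates, [p] being the
minimal period; hence the cardinal [d] is [p]. *)
Lemma orbit_length_min_period (M : topologicalType) (f : homeomorphism M M)
    (x : M) (d : nat) :
  periodic_map f -> orbit_has_length f x d ->
  iter d f x = x /\ forall k, (0 < k < d)%N -> iter k f x <> x.
Proof.
move=> [n [n0 fn _]] hd.
have ex : exists p, (0 < p)%N && `[< iter p f x = x >].
  by exists n; rewrite n0; apply/asboolP; rewrite fn.
case: (ex_minnP ex) => p /andP[p0 /asboolP fp] pmin.
have min k : (0 < k < p)%N -> iter k f x <> x.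
  move=> /andP[k0 kp] fk; suff : (p <= k)%N by rewrite leqNgt kp.
  by apply: pmin; rewrite k0; apply/asboolP.
pose S := [set iter j f x | j in `I_p].
have f_inj : injective f by apply: can_inj (hfunK f).
have Sf y : S y -> S (f y).
  move=> [j /= jp <-]; have [jp1|] := ltnP j.+1 p; first by exists j.+1.
  rewrite leq_eqVlt ltnS leqNgt jp orbF => /eqP pj.
  by exists 0%N; rewrite //= -[in LHS]fp pj.
have Sg y : S y -> S (hinv f y).
  move=> [[|j] /= jp <-]; last by exists j; rewrite /= ?hfunK // ltnW.
  exists p.-1; first by rewrite /= prednK.
  by rewrite -[in RHS]fp -[in RHS](prednK p0) /= hfunK.
have orbS : orbit_of f x = S.
  apply/seteqP; split=> [y [k _ <-]|y [j _ <-]]; last by exists (Posz j).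
  have S0 : S x by exists 0%N.
  case: k => k /=; last apply: (Sg).
    by elim: k => //= k; exact: Sf.
  by elim: k => //= k; exact: Sg.
have it_inj i : injective (iter i f).
  by elim: i => //= i IH a b /f_inj/IH.
have inj_lt i j : (i < j < p)%N -> iter i f x <> iter j f x.
  move=> /andP[ij jp] eij; apply: (min (j - i)%N).
    by rewrite subn_gt0 ij (leq_ltn_trans (leq_subr _ _) jp).
  by apply: (it_inj i); rewrite -iterD subnKC 1?ltnW.
have Sp : (S #= `I_p)%card.
  apply: inj_card_eq => i j /set_mem /= ip /set_mem /= jp eij.
  case: (ltngtP i j) => // ij.
    by case: (inj_lt i j) => //; rewrite ij.
  by case: (inj_lt j i) => //; rewrite ij.
have -> : d = p; last by [].
apply/card_eq_II; apply: card_eq_trans Sp.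
by rewrite card_eq_sym -orbS.
Qed.

(** * The dimension bound *)

Theorem proposition1p3 (R : realType) (M : topologicalType)
    (hM : compact_polyhedron R M) (hconn : connected [set: M])
    (f : homeomorphism M M) (hf : periodic_map f)
    (l : nat) (x : 'I_l -> M) (d : 'I_l -> nat)
    (hd : forall i, orbit_has_length f (x i) (d i))
    (hd1 : forall i, (1 < d i)%N)
    (hcop : forall i j, i != j -> coprime (d i) (d j))
    (m : nat) (e : M -> 'cV[R]_m) (he : equivariant_embedding f e) :
  (2 * l <= m)%N.
Proof.
have period i := orbit_length_min_period _ _ _ _ hf (hd i).
have move_x i : f (x i) <> x i by apply: ((period i).2 1%N); rewrite hd1.
case: he => -[_ e_inj _] [rho [rhoSO _] e_rho].
case: m => [|m] in e e_inj rho rhoSO e_rho *.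
  (* All points of R^0 coincide, so no point of [M] is moved. *)
  case: l => [|l] in x d hd hd1 hcop period move_x *; first by rewrite muln0.
  by case: (move_x ord0); apply: e_inj; rewrite !flatmx0.
have cyc_f : cyclic_group f (hpow f 1) by exists (Posz 1).
have [AAT detA] := rhoSO _ cyc_f.
pose B := (rho (hpow f 1))^T.
have eB y : (e (f y))^T = (e y)^T *m B.
  by rewrite -trmx_mul; congr trmx; apply: (congr1 (@^~ y) (e_rho _ cyc_f)).
have eBk k y : (e (iter k f y))^T = (e y)^T *m B ^+ k.
  by elim: k => [|k IH] /=; rewrite ?expr0 ?mulmx1 // eB IH exprSr mulmxA.
have BBT : B *m B^T = 1%:M by rewrite trmxK; apply: mulmx1C.
have detB : \det B = 1 by rewrite det_tr.
pose K i := kermxpoly B (geom_poly R (d i)).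
have rkK i : (2 <= \rank (K i))%N.
  apply: (rank_ker_geom_poly _ _ ((e (x i))^T - (e (x i))^T *m B)) => //.
  - exact: ltnW.
  - rewrite -eB subr_eq0; apply/eqP => /trmx_inj/e_inj/esym; exact: move_x.
  - by apply: geom_poly_horner_ker; rewrite -eBk (period i).1.
have dirK : mxdirect (\sum_i K i)%MS.
  apply: mxdirect_sum_kermx => i j _ _ ji.
  by apply: geom_poly_coprime; [exact: ltnW | apply: hcop; rewrite eq_sym].
have := rank_leq_row (\sum_i K i)%MS; rewrite (mxdirectP dirK) /=.
apply: leq_trans; rewrite mulnC -[X in (X * _)%N]card_ord -sum_nat_const.
exact: leq_sum.
Qed.
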